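(* Let $0<r<1$ and let $m\ge1$ be an integer. Any caustic curve of $R_r^{2m}$ is tangential to the unit circle at $(\cos\phi,\sin\phi)$ at any point $\phi$ satisfying $R_r^{2m}(\phi)=\phi$. In particular, this includes the points $0$, $\pi$, and $\pm\phi_c$, where $\phi_c\in(0,\pi)$ is given by $\cos\phi_c=\dfrac{1-\sqrt{1+8r^2}}{4r}$. Moreover, if $r\le 1/3$, these are the only four points at which the caustic meets the unit circle.
   Context: Points of the unit circle $S^1\subset\mathbb{R}^2$ are written as $\phi \bmod 2\pi$, standing for $(\cos\phi,\sin\phi)$; equalities of points of $S^1$ are modulo $2\pi$. For $0\le r<1$ the off-center reflection $R_r:S^1\to S^1$ is defined as follows: emit a ray from $(r,0)$ to $z\in S^1$, reflect it at $z$ with $S^1$ as the curve of reflection, and let $R_r(z)$ be the other point where the reflected ray hits $S^1$. Analytically, $R_r(\phi)=\phi+\pi-2\alpha(\phi) \pmod{2\pi}$ with $\alpha(\phi)=\operatorname{Arg}(\cos\phi-r+i\sin\phi)-\phi$ for $\phi\in(-\pi,\pi]$, where $\operatorname{Arg}$ is the principal argument with values in $(-\pi,\pi]$. $R_r^n$ denotes the $n$-fold composition of $R_r$ with itself. Derivatives of circle maps are derivatives of their lifts to $\mathbb{R}$. The caustic of a circle map $f:S^1\to S^1$ is the envelope of the family of lines joining $\phi$ to $f(\phi)$; it is the curve parametrized by $$x(\phi)=\frac{f'(\phi)\cos\phi+\cos f(\phi)}{1+f'(\phi)},\qquad y(\phi)=\frac{f'(\phi)\sin\phi+\sin f(\p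hi)}{1+f'(\phi)}.$$
   Formalization: Tangency at a fixed point is claimed only where 1+f'(φ)≠0 for f=R_r^{2m}, so that the caustic has a point there; for 0 and π this excludes exactly r=1/√5 with m odd, where the parametrization is 0/0 and the caustic escapes to infinity. *)

(* Defs.v *)
From Stdlib Require Import Reals Lra List.
From Coquelicot Require Import Coquelicot.
Open Scope R_scope.

(* Plane points are Coquelicot complex numbers, i.e. pairs of reals.  A point
   of the circle is given by an angle; two angles give the same point exactly
   when they agree modulo 2 pi. *)
Definition on_circle (phi : R) : C := (cos phi, sin phi).

(* Principal argument, with values in (-pi, pi] for z <> 0. *)
Definition Arg (z : C) : R :=
  if Rlt_dec (Im z) 0 then - acos (Re z / Cmod z) else acos (Re z / Cmod z).

(* The representative of phi modulo 2 pi in (-pi, pi]; see [principal_id]. *)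
Definition principal (phi : R) : R := Arg (on_circle phi).

Definition alpha (r phi : R) : R :=
  Arg (cos phi - r, sin phi) - principal phi.

(* The off-center reflection, as a map on angles.  Since [alpha r] is
   2 pi-periodic and smooth (see [alpha_atan]), this is a lift to the line of
   the circle map, and its iterates are lifts of the iterates. *)
Definition reflection (r phi : R) : R := phi + PI - 2 * alpha r phi.

Definition iter_reflection (r : R) (n : nat) : R -> R :=
  Nat.iter n (reflection r).

(* In the next two definitions f is a lift of a circle map.  The curve has a
   point at parameter phi only when the denominator is nonzero; otherwise the
   line joining phi to f phi has no (finite) point of contact given by the
   formula. *)
Definition caustic_defined (f : R -> R) (phi : R) : Prop :=
  1 + Derive f phi <> 0.

Definition caustic (f : R -> R) (phi : R) : C :=
  ((Derive f phi * cos phi + cos (f phi)) / (1 + Derive f phi),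
   (Derive f phi * sin phi + sin (f phi)) / (1 + Derive f phi)).

(* The points of the caustic lying on the unit circle. *)
Definition caustic_meets_circle (f : R -> R) (P : C) : Prop :=
  (exists phi, caustic_defined f phi /\ caustic f phi = P) /\ Cmod P = 1.

Definition cross (u v : C) : R := Re u * Im v - Im u * Re v.

(* The curve g has at parameter t0 the tangent line through g t0 with
   direction v: the secants from g t0 converge to that line.  At a regular
   point this is the line spanned by the velocity; it also covers cusps, where
   the velocity vanishes. *)
Definition has_tangent_line (g : R -> C) (t0 : R) (v : C) : Prop :=
  locally' t0 (fun t => g t <> g t0) /\
  is_lim (fun t => cross (Cminus (g t) (g t0)) v / Cmod (Cminus (g t) (g t0)))
    t0 0.

(* (- sin phi, cos phi) spans the tangent of the unit circle at
   (cos phi, sin phi). *)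
Definition tangent_to_circle_at (g : R -> C) (phi : R) : Prop :=
  g phi = on_circle phi /\ has_tangent_line g phi (- sin phi, cos phi).

Lemma Cmod_on_circle (phi : R) : Cmod (on_circle phi) = 1.
Proof.
  unfold Cmod, on_circle; simpl fst; simpl snd.
  replace (cos phi ^ 2 + sin phi ^ 2) with 1.
  - apply sqrt_1.
  - generalize (sin2_cos2 phi); unfold Rsqr; intros; lra.
Qed.

Lemma principal_id (phi : R) : - PI < phi <= PI -> principal phi = phi.
Proof.
  intros H. unfold principal, Arg. rewrite Cmod_on_circle.
  unfold on_circle, Re, Im; simpl fst; simpl snd.
  replace (cos phi / 1) with (cos phi) by field.
  destruct (Rlt_dec (sin phi) 0) as [Hs | Hs].
  - assert (phi < 0).
    { destruct (Rlt_dec phi 0) as [|Hn]; [assumption|].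
      assert (0 <= sin phi) by (apply sin_ge_0; lra). lra. }
    rewrite <- (cos_neg phi), acos_cos; lra.
  - assert (0 <= phi).
    { destruct (Rlt_dec phi 0) as [Hn|]; [|lra].
      assert (0 < sin (- phi)) by (apply sin_gt_0; lra).
      rewrite sin_neg in *. lra. }
    apply acos_cos; lra.
Qed.

Lemma Arg_polar (z : C) : 0 < Cmod z ->
  Re z = Cmod z * cos (Arg z) /\ Im z = Cmod z * sin (Arg z).
Proof.
  intros Hz.
  assert (Hsq : Cmod z * Cmod z = Re z * Re z + Im z * Im z).
  { generalize (Cmod2_alt z). simpl. intros; lra. }
  set (q := Re z / Cmod z).
  assert (Hq : Re z = Cmod z * q) by (unfold q; field; lra).
  assert (Hq1 : 1 - q² = (Im z / Cmod z)²).
  { unfold q, Rsqr. field_simplify_eq; [|lra]. simpl. lra. }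
  assert (Hb : -1 <= q <= 1).
  { assert (0 <= (Im z / Cmod z)²) by apply Rle_0_sqr.
    unfold Rsqr in *. split; nra. }
  unfold Arg. fold q. destruct (Rlt_dec (Im z) 0) as [Hi | Hi].
  - rewrite cos_neg, sin_neg, cos_acos, sin_acos, Hq1, sqrt_Rsqr_abs by assumption.
    split; [assumption|].
    rewrite Rabs_left; [field; lra|].
    apply Rmult_lt_reg_r with (Cmod z); [assumption|].
    unfold Rdiv. rewrite Rmult_assoc, Rinv_l by lra. lra.
  - rewrite cos_acos, sin_acos, Hq1, sqrt_Rsqr_abs by assumption.
    split; [assumption|].
    rewrite Rabs_pos_eq; [field; lra|].
    apply Rmult_le_reg_r with (Cmod z); [assumption|].
    unfold Rdiv. rewrite Rmult_assoc, Rinv_l by lra. lra.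
Qed.

Lemma alpha_atan (r phi : R) : 0 <= r < 1 ->
  alpha r phi = atan (r * sin phi / (1 - r * cos phi)).
Proof.
  intros Hr.
  assert (Hc := COS_bound phi).
  assert (Hcs := sin2_cos2 phi). unfold Rsqr in Hcs.
  assert (Hd : 0 < 1 - r * cos phi) by nra.
  set (w := (cos phi - r, sin phi) : C).
  assert (Hw : 0 < Cmod w).
  { apply Cmod_gt_0. intros E. unfold w in E.
    assert (E1 := f_equal fst E). assert (E2 := f_equal snd E). simpl in E1, E2.
    rewrite E2 in Hcs. nra. }
  assert (H1 : 0 < Cmod (on_circle phi)) by (rewrite Cmod_on_circle; lra).
  destruct (Arg_polar w Hw) as [Wx Wy].
  destruct (Arg_polar (on_circle phi) H1) as [Px Py].
  rewrite Cmod_on_circle, Rmult_1_l in Px, Py.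
  unfold alpha, principal. fold w.
  set (p := Arg w) in *. set (t := Arg (on_circle phi)) in *.
  unfold w, on_circle, Re, Im in Wx, Wy, Px, Py. simpl in Wx, Wy, Px, Py.
  fold w in Wx, Wy.
  assert (Hcos : Cmod w * cos (p - t) = 1 - r * cos phi).
  { rewrite cos_minus, Rmult_plus_distr_l, <- !Rmult_assoc, <- Wx, <- Wy, <- Px, <- Py.
    nra. }
  assert (Hsin : Cmod w * sin (p - t) = r * sin phi).
  { rewrite sin_minus, Rmult_minus_distr_l, <- !Rmult_assoc, <- Wx, <- Wy, <- Px, <- Py.
    nra. }
  assert (Hpos : 0 < cos (p - t)) by nra.
  assert (Hrange : - PI <= p - t <= PI).
  { assert (A1 := acos_bound (Re w / Cmod w)).
    assert (A2 := acos_bound (Re (on_circle phi) / Cmod (on_circle phi))).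
    unfold p, t, Arg.
    destruct (Rlt_dec (Im w) 0) as [i|i]; unfold w, Im in i; simpl in i;
    destruct (Rlt_dec (Im (on_circle phi)) 0) as [j|j];
      unfold on_circle, Im in j; simpl in j; lra. }
  assert (Hhalf : - (PI / 2) < p - t < PI / 2).
  { assert (HPI := PI_RGT_0). split.
    - destruct (Rlt_dec (- (PI / 2)) (p - t)) as [|n]; [assumption|].
      assert (cos (- (p - t)) <= 0) by (apply cos_le_0; lra).
      rewrite cos_neg in *. lra.
    - destruct (Rlt_dec (p - t) (PI / 2)) as [|n]; [assumption|].
      assert (cos (p - t) <= 0) by (apply cos_le_0; lra). lra. }
  rewrite <- (atan_tan (p - t) Hhalf). f_equal.
  unfold tan. rewrite <- Hcos, <- Hsin. field. lra.
Qed.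

Lemma ex_derive_iter_reflection (r : R) (n : nat) (phi : R) :
  0 <= r < 1 -> ex_derive (iter_reflection r n) phi.
Proof.
  intros Hr. revert phi. induction n as [|n IH]; intros phi.
  - apply ex_derive_id.
  - apply (ex_derive_comp (reflection r) (iter_reflection r n)); [|apply IH].
    apply ex_derive_ext with
      (fun x => x + PI - 2 * atan (r * sin x / (1 - r * cos x))).
    { intros x. unfold reflection. now rewrite alpha_atan. }
    generalize (iter_reflection r n phi). intros x.
    assert (Hc := COS_bound x).
    auto_derive. nra.
Qed.

Lemma reflection_lift (r phi : R) :
  reflection r (phi + 2 * PI) = reflection r phi + 2 * PI.
Proof.
  unfold reflection, alpha, principal, on_circle.
  rewrite cos_plus, sin_plus, cos_2PI, sin_2PI, !Rmult_1_r, !Rmult_0_r.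
  rewrite Rminus_0_r, Rplus_0_r. ring.
Qed.

(* Main.v *)
(** At a fixed point [t0] of [f], the caustic touches the circle to first order
    as soon as [f - f t0], [f'] and [t - t0] have positive product near [t0];
    this holds also where [f'] vanishes.  The property passes to compositions,
    and the reflection has it because its critical points are isolated.

    If [R (R x) = x + 2 pi] then [alpha (R x) = - alpha x].  The sine rule
    [sin alpha = r sin (x + alpha)] at [x] and at [R x] then gives
    [sin (x + alpha) = sin (x - 3 alpha)], hence either [sin x = 0] or the chord
    is vertical, which is the quadratic equation defining [phi_c].

    For [r <= 1/3] the reflection is monotone of rotation number 1/2, so the
    fixed points of its even iterates are those of [R^2].  There [f' >= 0], so a
    point of the caustic on the circle comes from a fixed point or from
    [f' = 0]; in the latter case the orbit passes through [0], where [r = 1/3],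
    and stays in [{0, pi}]. *)
Require Import Defs.
From Stdlib Require Import Reals Lra Lia List.
From Coquelicot Require Import Coquelicot.
Open Scope R_scope.

(** * Trigonometric identities for points of the circle *)

Lemma on_circle_eq (x y : R) :
  cos x = cos y -> sin x = sin y -> on_circle x = on_circle y.
Proof. unfold on_circle. now intros -> ->. Qed.

Lemma on_circle_inj (x y : R) :
  on_circle x = on_circle y -> cos x = cos y /\ sin x = sin y.
Proof. unfold on_circle. intros [= H1 H2]. now split. Qed.

Lemma sin_cos_sqr (x : R) : sin x * sin x + cos x * cos x = 1.
Proof. generalize (sin2_cos2 x). now unfold Rsqr. Qed.

Lemma cos_shift (x y : R) : cos x = cos (x - y) * cos y - sin (x - y) * sin y.
Proof. rewrite <- cos_plus. f_equal. ring. Qed.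

Lemma sin_shift (x y : R) : sin x = sin (x - y) * cos y + cos (x - y) * sin y.
Proof. rewrite <- sin_plus. f_equal. ring. Qed.

Lemma cos_half (x : R) : cos x = 1 - 2 * sin (x / 2) * sin (x / 2).
Proof. rewrite <- cos_2a_sin. f_equal. field. Qed.

Lemma sin_half (x : R) : sin x = 2 * sin (x / 2) * cos (x / 2).
Proof. rewrite <- sin_2a. f_equal. field. Qed.

Lemma sin_same_sign (x : R) : x <> 0 -> Rabs x < PI -> 0 < x * sin x.
Proof.
  intros Hx H. apply Rabs_def2 in H. destruct (Rdichotomy _ _ Hx) as [N|N].
  - assert (0 < sin (- x)) by (apply sin_gt_0; lra).
    rewrite sin_neg in *. nra.
  - assert (0 < sin x) by (apply sin_gt_0; lra). nra.
Qed.

(** * Tangency of the caustic at a fixed point of a circle map *)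

Lemma locally_pos (h : R -> R) (x : R) :
  continuous h x -> 0 < h x -> locally x (fun t => 0 < h t).
Proof. intros Hc H. apply (Hc (fun y => 0 < y)). now apply open_gt. Qed.

(** The quotient of [1 - cos x] by [Rabs (sin x)] is [Rabs (tan (x / 2))]; the last hypothesis
    bounds this tangent by [eps] without dividing. *)
Lemma one_minus_cos_small (eps x : R) :
  x <> 0 -> Rabs x < PI -> 0 < eps * cos (x / 2) - Rabs (sin (x / 2)) ->
  1 - cos x < eps * Rabs (sin x).
Proof.
  intros Hx Hb H.
  assert (S := sin_same_sign x Hx Hb).
  assert (Hc : 0 < cos (x / 2)).
  { apply Rabs_def2 in Hb. apply cos_gt_0; lra. }
  rewrite (cos_half x). rewrite (sin_half x) in *.
  rewrite !Rabs_mult, (Rabs_pos_eq 2), (Rabs_pos_eq (cos (x / 2))) by lra.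
  assert (0 < Rabs (sin (x / 2))) by (apply Rabs_pos_lt; intros E; rewrite E in S; lra).
  assert (sin (x / 2) * sin (x / 2) = Rabs (sin (x / 2)) * Rabs (sin (x / 2)))
    by (rewrite <- Rabs_mult, Rabs_pos_eq; [easy|nra]).
  nra.
Qed.

(** Serves for both displacements [t - t0] and [f t - f t0] at a fixed point. *)
Lemma one_minus_cos_small_locally (eps : R) (u : R -> R) (t0 : R) :
  0 < eps -> continuous u t0 -> u t0 = 0 ->
  locally t0 (fun t => u t <> 0 -> 1 - cos (u t) < eps * Rabs (sin (u t)) /\ 0 < u t * sin (u t)).
Proof.
  intros He Hu H0.
  assert (L1 : locally t0 (fun t => 0 < PI - Rabs (u t))).
  { apply (locally_pos (fun t => PI - Rabs (u t))).
    - apply (continuous_minus (fun _ => PI)); [apply continuous_const|].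
      apply continuous_comp; [easy|apply continuous_Rabs].
    - rewrite H0, Rabs_R0. generalize PI_RGT_0. lra. }
  assert (L2 : locally t0 (fun t => 0 < eps * cos (u t / 2) - Rabs (sin (u t / 2)))).
  { apply (locally_pos (fun t => eps * cos (u t / 2) - Rabs (sin (u t / 2)))).
    - apply (continuous_comp u (fun y => eps * cos (y / 2) - Rabs (sin (y / 2)))); [easy|].
      apply (continuous_minus (fun y => eps * cos (y / 2))).
      + apply (ex_derive_continuous (fun y => eps * cos (y / 2))). now auto_derive.
      + apply (continuous_comp (fun y => sin (y / 2)) Rabs); [|apply continuous_Rabs].
        apply (ex_derive_continuous (fun y => sin (y / 2))). now auto_derive.
    - rewrite H0. replace (0 / 2) with 0 by field. rewrite cos_0, sin_0, Rabs_R0. lra. }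
  generalize (filter_and _ _ L1 L2). apply filter_imp.
  intros t [A B] N. split.
  - apply one_minus_cos_small; lra.
  - apply sin_same_sign; lra.
Qed.

(* The sign of [Derive h t] agrees with that of the secant slope; it may change
   across [t0]. *)
Definition punctured_monotone (h : R -> R) (t0 : R) : Prop :=
  locally' t0 (fun t => 0 < (h t - h t0) * Derive h t * (t - t0)).

(** By the chain rule, the product for [h] at [k t] times the one for [k] at [t] is the product for
    the composite times [(k t - k t0) ^ 2]. Positivity for [k] forces [k t <> k t0], so the square
    cancels. *)
Lemma punctured_monotone_comp (h k : R -> R) (t0 : R) :
  (forall x, ex_derive h x) -> (forall x, ex_derive k x) ->
  punctured_monotone k t0 -> punctured_monotone h (k t0) ->
  punctured_monotone (fun t => h (k t)) t0.
Proof.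
  intros Dh Dk Hk Hh.
  assert (Hh' : locally t0 (fun t => k t <> k t0 ->
     0 < (h (k t) - h (k t0)) * Derive h (k t) * (k t - k t0))).
  { apply (ex_derive_continuous k t0 (Dk t0)
      (fun y => y <> k t0 -> 0 < (h y - h (k t0)) * Derive h y * (y - k t0))).
    exact Hh. }
  unfold punctured_monotone, locally', within in *.
  generalize (filter_and _ _ Hk Hh'). apply filter_imp.
  intros t [A B] N. specialize (A N).
  assert (V : k t <> k t0) by (intros E; rewrite E in A; lra).
  specialize (B V). rewrite Derive_comp by easy.
  assert (0 < (k t - k t0) ^ 2) by (apply pow2_gt_0; lra).
  assert (0 < ((h (k t) - h (k t0)) * Derive h (k t) * (k t - k t0)) *
              ((k t - k t0) * Derive k t * (t - t0))) by now apply Rmult_lt_0_compat.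
  apply Rmult_lt_reg_l with ((k t - k t0) ^ 2); [easy|]. nra.
Qed.

(* In the frame rotated by [- t0], with [s = t - t0] and [u = f t - f t0], the
   point of the caustic minus [(1, 0)] is
   [(f' (cos s - 1) + cos u - 1, f' sin s + sin u) / (1 + f')].  Since
   [f' sin s] and [sin u] have the same sign, nothing cancels in the second
   coordinate, so the first one is negligible even if [f' t0 = 0]. *)
Lemma tangent_at_fixed_point (f : R -> R) (t0 : R) :
  on_circle (f t0) = on_circle t0 -> continuous f t0 ->
  continuous (Derive f) t0 -> caustic_defined f t0 ->
  punctured_monotone f t0 -> tangent_to_circle_at (caustic f) t0.
Proof.
  intros Hfix Cf Cd Hdef Hm.
  destruct (on_circle_inj _ _ Hfix) as [Ec Es].
  unfold caustic_defined in Hdef.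
  assert (G0 : caustic f t0 = on_circle t0).
  { unfold caustic, on_circle. rewrite Ec, Es. f_equal; field; easy. }
  split; [exact G0|].
  (* One estimate yields both halves of [has_tangent_line]: the curve leaves its base point, and the
     secants converge. *)
  assert (Key : forall eps, 0 < eps -> locally' t0 (fun t =>
    0 < Cmod (Cminus (caustic f t) (caustic f t0)) /\
    Rabs (cross (Cminus (caustic f t) (caustic f t0)) (- sin t0, cos t0))
      < eps * Cmod (Cminus (caustic f t) (caustic f t0)))).
  { intros eps He.
    assert (L1 := one_minus_cos_small_locally eps (fun t => t - t0) t0 He).
    assert (L2 := one_minus_cos_small_locally eps (fun t => f t - f t0) t0 He).
    (* The fixed factor [1 + Derive f t0] makes the product positive at [t0] whatever its sign, so
       the denominator stays nonzero nearby. *)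
    assert (L3 : locally t0 (fun t => 0 < (1 + Derive f t) * (1 + Derive f t0))).
    { apply (locally_pos (fun t => (1 + Derive f t) * (1 + Derive f t0))).
      - apply (continuous_mult (fun t => 1 + Derive f t)); [|apply continuous_const].
        apply (continuous_plus (fun _ => 1)); [apply continuous_const|easy].
      - assert (0 < (1 + Derive f t0) ^ 2) by (apply pow2_gt_0; easy). lra. }
    lapply L1; [clear L1; intros L1|].
    2:{ apply (ex_derive_continuous (fun t => t - t0)). now auto_derive. }
    lapply L2; [clear L2; intros L2|].
    2:{ apply (continuous_minus f); [easy|apply continuous_const]. }
    specialize (L1 ltac:(lra)). specialize (L2 ltac:(lra)). cbv beta in L1, L2.
    unfold punctured_monotone, locally', within in *.
    generalize (filter_and _ _ Hm (filter_and _ _ L1 (filter_and _ _ L2 L3))).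
    apply filter_imp. clear L1 L2 L3 Hm. intros t [M [A1 [A2 A3]]] N.
    specialize (M N). rewrite G0.
    set (D := Derive f t) in *. set (s := t - t0) in *. set (u := f t - f t0) in *.
    assert (Hs : s <> 0) by (unfold s; lra).
    assert (Hu : u <> 0) by (intros E; rewrite E in M; lra).
    destruct (A1 Hs) as [B1 S1]. destruct (A2 Hu) as [B2 S2]. clear A1 A2.
    assert (HE : 1 + D <> 0) by (intros E; rewrite E in A3; lra).
    set (d := Cminus (caustic f t) (on_circle t0)).
    assert (T1 : cos t = cos s * cos t0 - sin s * sin t0).
    { apply cos_shift. }
    assert (T2 : sin t = sin s * cos t0 + cos s * sin t0).
    { apply sin_shift. }
    assert (T3 : cos (f t) = cos u * cos t0 - sin u * sin t0).
    { rewrite <- Ec, <- Es. apply cos_shift. }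
    assert (T4 : sin (f t) = sin u * cos t0 + cos u * sin t0).
    { rewrite <- Ec, <- Es. apply sin_shift. }
    assert (Hcs := sin_cos_sqr t0).
    (* The cross product is the coordinate of [d] along the radius at [t0]; [Y] below is the one
       along the tangent. *)
    assert (X : cross d (- sin t0, cos t0) * (1 + D) = - (D * (1 - cos s) + (1 - cos u))).
    { transitivity (- (D * (1 - cos s) + (1 - cos u)) * (sin t0 * sin t0 + cos t0 * cos t0));
        [|rewrite Hcs; ring].
      unfold cross, d, caustic, on_circle, Cminus, Cplus, Copp, Re, Im. simpl. fold D.
      rewrite T1, T2, T3, T4. field. easy. }
    set (Y := Im d * cos t0 - Re d * sin t0).
    assert (HY : Y * (1 + D) = D * sin s + sin u).
    { transitivity ((D * sin s + sin u) * (sin t0 * sin t0 + cos t0 * cos t0));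
        [|rewrite Hcs; ring].
      unfold Y, d, caustic, on_circle, Cminus, Cplus, Copp, Re, Im. simpl. fold D.
      rewrite T1, T2, T3, T4. field. easy. }
    assert (SS : 0 < (D * sin s) * sin u).
    { assert (0 < (u * D * s) * ((s * sin s) * (u * sin u)))
        by (apply Rmult_lt_0_compat; [easy|now apply Rmult_lt_0_compat]).
      assert (0 < (s * u) ^ 2).
      { apply pow2_gt_0. now apply Rmult_integral_contrapositive_currified. }
      apply Rmult_lt_reg_l with ((s * u) ^ 2); [easy|]. nra. }
    assert (HA : Rabs (D * sin s + sin u) = Rabs D * Rabs (sin s) + Rabs (sin u)).
    { rewrite <- Rabs_mult. set (p := D * sin s) in *. set (q := sin u) in *.
      unfold Rabs. repeat destruct Rcase_abs; nra. }
    assert (HXY : Rabs (cross d (- sin t0, cos t0)) < eps * Rabs Y).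
    { apply Rmult_lt_reg_r with (Rabs (1 + D)); [now apply Rabs_pos_lt|].
      rewrite Rmult_assoc, <- !Rabs_mult, X, HY, Rabs_Ropp, HA.
      apply Rle_lt_trans with (Rabs D * (1 - cos s) + (1 - cos u)).
      - eapply Rle_trans; [apply Rabs_triang|]. rewrite Rabs_mult.
        rewrite (Rabs_pos_eq (1 - cos s)), (Rabs_pos_eq (1 - cos u)).
        + lra.
        + generalize (COS_bound u). lra.
        + generalize (COS_bound s). lra.
      - assert (Rabs D * (1 - cos s) <= Rabs D * (eps * Rabs (sin s)))
          by (apply Rmult_le_compat_l; [apply Rabs_pos|lra]).
        lra. }
    assert (HYC : Rabs Y <= Cmod d).
    { rewrite <- (sqrt_Rsqr_abs Y). unfold Cmod. apply sqrt_le_1_alt.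
      unfold Rsqr, Y, Re, Im.
      assert (0 <= (fst d * cos t0 + snd d * sin t0) ^ 2) by apply pow2_ge_0.
      replace (fst d ^ 2 + snd d ^ 2) with
        ((fst d ^ 2 + snd d ^ 2) * (sin t0 * sin t0 + cos t0 * cos t0))
        by (rewrite Hcs; ring).
      nra. }
    assert (HY0 : 0 < Rabs Y).
    { apply Rabs_pos_lt. intros E. rewrite E in HY.
      assert (E' : D * sin s = - sin u) by lra. rewrite E' in SS. nra. }
    split; [lra|]. nra. }
  split.
  - generalize (Key 1 Rlt_0_1). apply filter_imp. intros t [A _] E.
    rewrite E in A. replace (Cminus (caustic f t0) (caustic f t0)) with (RtoC 0) in A by ring.
    rewrite Cmod_0 in A. lra.
  - apply filterlim_locally. intros eps.
    generalize (Key eps (cond_pos eps)). apply filter_imp. intros t [A B].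
    unfold ball; simpl; unfold AbsRing_ball, abs, minus, plus, opp; simpl.
    rewrite Ropp_0, Rplus_0_r. unfold Rdiv.
    rewrite Rabs_mult, (Rabs_pos_eq (/ _)) by (left; now apply Rinv_0_lt_compat).
    apply Rmult_lt_reg_r with (1 := A).
    rewrite Rmult_assoc, Rinv_l by lra. lra.
Qed.

(** * Derivatives of the reflection and of its iterates *)

(** Rotated by [- x], the vector from the source to the point at angle [x] becomes
    [(1 - r * cos x, r * sin x)]; [rho] is its length and [alpha r x] its argument. *)
Lemma alpha_polar (r x : R) : 0 <= r < 1 ->
  0 < cos (alpha r x) /\ exists rho, 0 < rho /\
    rho * cos (alpha r x) = 1 - r * cos x /\ rho * sin (alpha r x) = r * sin x.
Proof.
  intros Hr. rewrite alpha_atan by easy.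
  assert (Hc := COS_bound x).
  assert (Hd : 0 < 1 - r * cos x) by nra.
  set (q := r * sin x / (1 - r * cos x)).
  assert (B := atan_bound q).
  assert (P : 0 < cos (atan q)) by (apply cos_gt_0; lra).
  split; [easy|]. exists ((1 - r * cos x) / cos (atan q)). repeat split.
  - now apply Rdiv_lt_0_compat.
  - field. lra.
  - assert (T := tan_atan q). unfold tan in T.
    replace ((1 - r * cos x) / cos (atan q) * sin (atan q))
      with ((1 - r * cos x) * (sin (atan q) / cos (atan q))) by (field; lra).
    rewrite T. unfold q. field. lra.
Qed.

(** The denominator is the squared distance from the source to the point at angle [x]. *)
Definition reflection_deriv (r x : R) : R :=
  (1 + 3 * r ^ 2 - 4 * r * cos x) / (1 + r ^ 2 - 2 * r * cos x).

Lemma reflection_deriv_den (r x : R) : 0 <= r < 1 ->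
  0 < 1 + r ^ 2 - 2 * r * cos x.
Proof.
  intros Hr. assert (Hc := COS_bound x).
  assert (0 < (1 - r) ^ 2) by (apply pow2_gt_0; lra). nra.
Qed.

Lemma is_derive_reflection (r x : R) : 0 <= r < 1 ->
  is_derive (reflection r) x (reflection_deriv r x).
Proof.
  intros Hr.
  apply is_derive_ext with
    (fun x => x + PI - 2 * atan (r * sin x / (1 - r * cos x))).
  { intros y. unfold reflection. now rewrite alpha_atan. }
  assert (Hc := COS_bound x). assert (Hd := reflection_deriv_den r x Hr).
  assert (Hd' : 0 < 1 - r * cos x) by nra.
  auto_derive; [lra|]. unfold reflection_deriv.
  assert (Hs : sin x * sin x = 1 - cos x * cos x) by (generalize (sin_cos_sqr x); lra).
  assert (E : 1 + r * sin x / (1 - r * cos x) * (r * sin x / (1 - r * cos x)) =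
    (1 + r ^ 2 - 2 * r * cos x) / ((1 - r * cos x) * (1 - r * cos x))).
  { field_simplify_eq; [|lra]. replace (sin x ^ 2) with (sin x * sin x) by ring.
    rewrite Hs. ring. }
  unfold Rsqr, Rminus, Rdiv in *. rewrite ?Rmult_1_r, ?Rmult_1_l, E.
  field_simplify_eq; [|lra].
  replace (sin x ^ 2) with (sin x * sin x) by ring. rewrite Hs. ring.
Qed.

Lemma Derive_reflection (r x : R) : 0 <= r < 1 ->
  Derive (reflection r) x = reflection_deriv r x.
Proof. intros Hr. apply is_derive_unique. now apply is_derive_reflection. Qed.

Lemma ex_derive_reflection (r x : R) : 0 <= r < 1 -> ex_derive (reflection r) x.
Proof. intros Hr. eexists. now apply is_derive_reflection. Qed.

Lemma Derive_iter_0 (r x : R) : Derive (iter_reflection r 0) x = 1.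
Proof. apply Derive_id. Qed.

Lemma Derive_iter_S (r : R) (n : nat) (x : R) : 0 <= r < 1 ->
  Derive (iter_reflection r (S n)) x =
  reflection_deriv r (iter_reflection r n x) * Derive (iter_reflection r n) x.
Proof.
  intros Hr. change (iter_reflection r (S n)) with
    (fun x => reflection r (iter_reflection r n x)).
  rewrite Derive_comp.
  - rewrite Derive_reflection by easy. ring.
  - now apply ex_derive_reflection.
  - now apply ex_derive_iter_reflection.
Qed.

Lemma continuous_Derive_iter (r : R) (n : nat) (x : R) : 0 <= r < 1 ->
  continuous (Derive (iter_reflection r n)) x.
Proof.
  intros Hr. induction n as [|n IH].
  - apply continuous_ext with (fun _ => 1); [|apply continuous_const].
    intros t. symmetry. apply Derive_iter_0.
  - apply continuous_ext with (fun t =>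
      reflection_deriv r (iter_reflection r n t) * Derive (iter_reflection r n) t).
    { intros t. symmetry. now apply Derive_iter_S. }
    apply (continuous_mult (fun t => reflection_deriv r (iter_reflection r n t))); [|easy].
    apply (continuous_comp (iter_reflection r n) (reflection_deriv r)).
    + apply (ex_derive_continuous (iter_reflection r n)).
      now apply ex_derive_iter_reflection.
    + apply (ex_derive_continuous (reflection_deriv r)).
      assert (Hd := reflection_deriv_den r (iter_reflection r n x) Hr).
      unfold reflection_deriv. auto_derive. simpl in Hd. lra.
Qed.

(** * Isolated critical points, and tangency for the iterates *)

Lemma locally_radius (P : R -> Prop) (x : R) :
  locally x P -> exists d, 0 < d /\ forall y, Rabs (y - x) < d -> P y.
Proof. intros [d H]. exists d. split; [apply cond_pos|exact H]. Qed.

(* [N] is the numerator of the derivative of the reflection. *)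
Lemma critical_factor_sign (r t0 : R) : 0 < r ->
  let N := fun y => 1 + 3 * r ^ 2 - 4 * r * cos y in
  exists d, 0 < d /\ forall y z, Rabs (y - t0) < d -> Rabs (z - t0) < d ->
    0 < (y - t0) * (z - t0) -> 0 < N y * N z.
Proof.
  intros Hr N. destruct (Req_dec (N t0) 0) as [E|E].
  - assert (F : forall y, N y = 4 * r * (cos t0 - cos y)) by (unfold N in *; intros y; lra).
    destruct (Req_dec (sin t0) 0) as [S|S].
    (* A double zero of [N]: [N t0 = 0] makes [cos t0] positive, and [N] is then positive on both
       sides of [t0]. *)
    + exists PI. split; [apply PI_RGT_0|].
      assert (Hcp : 0 < cos t0) by (unfold N in E; nra).
      assert (Pos : forall y, Rabs (y - t0) < PI -> y - t0 <> 0 -> 0 < N y).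
      { intros y Hy Hn. rewrite F, (cos_shift y t0), S.
        assert (Q := sin_same_sign _ Hn Hy).
        assert (sin (y - t0) <> 0) by (intros Z; rewrite Z in Q; lra).
        assert (0 < sin (y - t0) ^ 2) by now apply pow2_gt_0.
        assert (A := sin_cos_sqr (y - t0)). assert (B := COS_bound (y - t0)).
        assert (cos (y - t0) < 1) by nra.
        assert (0 < r * cos t0) by nra. nra. }
      intros y z Hy Hz Hyz. apply Rmult_lt_0_compat; apply Pos; try easy;
        intros Z; rewrite Z in Hyz; lra.
    (* A simple zero: the sum-to-product formula splits [N y] into a factor of constant sign near
       [t0] and [sin ((y - t0) / 2)], which has the sign of [y - t0]. *)
    + assert (L : locally t0 (fun y => 0 < sin ((y + t0) / 2) * sin t0)).
      { apply (locally_pos (fun y => sin ((y + t0) / 2) * sin t0)).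
        - apply (ex_derive_continuous (fun y => sin ((y + t0) / 2) * sin t0)).
          now auto_derive.
        - replace ((t0 + t0) / 2) with t0 by field.
          assert (0 < sin t0 ^ 2) by now apply pow2_gt_0. lra. }
      destruct (locally_radius _ _ L) as [d [Hd H]].
      exists (Rmin d PI). assert (HP := PI_RGT_0). split; [now apply Rmin_pos|].
      intros y z Hy Hz Hyz.
      assert (Hy1 := Rlt_le_trans _ _ _ Hy (Rmin_l _ _)).
      assert (Hy2 := Rlt_le_trans _ _ _ Hy (Rmin_r _ _)).
      assert (Hz1 := Rlt_le_trans _ _ _ Hz (Rmin_l _ _)).
      assert (Hz2 := Rlt_le_trans _ _ _ Hz (Rmin_r _ _)).
      assert (A := Rmult_lt_0_compat _ _ (H y Hy1) (H z Hz1)).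
      assert (B : forall w, Rabs (w - t0) < PI -> w - t0 <> 0 ->
         0 < (w - t0) * sin ((w - t0) / 2)).
      { intros w Hw Hn. apply Rabs_def2 in Hw.
        assert (0 < (w - t0) / 2 * sin ((w - t0) / 2)); [|lra].
        apply sin_same_sign; [lra|]. apply Rabs_def1; lra. }
      assert (By := B y Hy2 ltac:(intros Z; rewrite Z in Hyz; lra)).
      assert (Bz := B z Hz2 ltac:(intros Z; rewrite Z in Hyz; lra)).
      assert (BB := Rmult_lt_0_compat _ _ By Bz).
      assert (F' : forall w, N w = 8 * r * (sin ((w + t0) / 2) * sin ((w - t0) / 2))).
      { intros w. rewrite F, form2.
        replace ((t0 - w) / 2) with (- ((w - t0) / 2)) by field. rewrite sin_neg.
        replace (t0 + w) with (w + t0) by ring. ring. }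
      rewrite !F'.
      set (a := sin ((y + t0) / 2)) in *. set (b := sin ((z + t0) / 2)) in *.
      set (p := sin ((y - t0) / 2)) in *. set (q := sin ((z - t0) / 2)) in *.
      set (e := sin t0) in *. set (Y := y - t0) in *. set (Z := z - t0) in *.
      assert (0 < a * b).
      { assert (0 < e ^ 2) by now apply pow2_gt_0.
        apply Rmult_lt_reg_l with (e ^ 2); [easy|]. lra. }
      assert (0 < p * q).
      { apply Rmult_lt_reg_l with (Y * Z); [easy|]. lra. }
      assert (0 < (a * b) * (p * q)) by now apply Rmult_lt_0_compat.
      assert (0 < r ^ 2) by nra.
      assert (0 < r ^ 2 * ((a * b) * (p * q))) by now apply Rmult_lt_0_compat.
      lra.
  - assert (L : locally t0 (fun y => 0 < N y * N t0)).
    { apply (locally_pos (fun y => N y * N t0)).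
      - apply (ex_derive_continuous (fun y => N y * N t0)). unfold N. now auto_derive.
      - assert (0 < N t0 ^ 2) by now apply pow2_gt_0. lra. }
    destruct (locally_radius _ _ L) as [d [Hd H]]. exists d. split; [easy|].
    intros y z Hy Hz _. assert (A := Rmult_lt_0_compat _ _ (H y Hy) (H z Hz)).
    assert (0 < N t0 ^ 2) by now apply pow2_gt_0.
    apply Rmult_lt_reg_l with (N t0 ^ 2); [easy|]. lra.
Qed.

(** Covers both orders of [x] and [y], and records the position of [z] in the form that
    [critical_factor_sign] takes. *)
Lemma MVT_open (h : R -> R) (x y : R) : (forall z, ex_derive h z) -> x <> y ->
  exists z, h y - h x = Derive h z * (y - x) /\ 0 < (z - x) * (y - x) /\
    Rabs (z - x) < Rabs (y - x).
Proof.
  intros H N.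
  assert (D : forall c, derivable_pt_lim h c (Derive h c)).
  { intros c. apply is_derive_Reals. now apply Derive_correct. }
  destruct (Rdichotomy _ _ N) as [L|L].
  - destruct (MVT_cor2 h (Derive h) x y L (fun c _ => D c)) as [c [E B]].
    exists c. rewrite !Rabs_pos_eq by lra. repeat split; [easy|nra|lra].
  - destruct (MVT_cor2 h (Derive h) y x L (fun c _ => D c)) as [c [E B]].
    exists c. rewrite !Rabs_left by lra. repeat split; [lra|nra|lra].
Qed.

(** The secant slope is the derivative at some [z] between [t0] and [t]. As [z] and [t] lie on the
    same side of [t0], the derivatives there have the same sign. *)
Lemma punctured_monotone_reflection (r t0 : R) : 0 < r < 1 ->
  punctured_monotone (reflection r) t0.
Proof.
  intros Hr. assert (Hr' : 0 <= r < 1) by lra.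
  destruct (critical_factor_sign r t0 (proj1 Hr)) as [d [Hd H]].
  exists (mkposreal d Hd). intros t Ht Hn. simpl in Ht.
  change (Rabs (t - t0) < d) in Ht.
  destruct (MVT_open (reflection r) t0 t) as [z [E [B1 B2]]].
  - intros z. now apply ex_derive_reflection.
  - now intros e; apply Hn.
  - rewrite E, !Derive_reflection by easy.
    assert (P := H z t ltac:(lra) Ht B1). unfold reflection_deriv.
    assert (D1 := reflection_deriv_den r z Hr'). assert (D2 := reflection_deriv_den r t Hr').
    set (p := 1 + 3 * r ^ 2 - 4 * r * cos z) in *.
    set (q := 1 + 3 * r ^ 2 - 4 * r * cos t) in *.
    set (a := 1 + r ^ 2 - 2 * r * cos z) in *. set (b := 1 + r ^ 2 - 2 * r * cos t) in *.
    replace (p / a * (t - t0) * (q / b) * (t - t0)) with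
      ((p * q) * (t - t0) ^ 2 * (/ a * / b)) by (field; lra).
    assert (0 < (t - t0) ^ 2) by (apply pow2_gt_0; intros e; apply Hn; lra).
    apply Rmult_lt_0_compat; [now apply Rmult_lt_0_compat|].
    apply Rmult_lt_0_compat; now apply Rinv_0_lt_compat.
Qed.

Lemma punctured_monotone_iter (r : R) (n : nat) (t0 : R) : 0 < r < 1 ->
  punctured_monotone (iter_reflection r n) t0.
Proof.
  intros Hr. revert t0. induction n as [|n IH]; intros t0.
  - exists (mkposreal 1 Rlt_0_1). intros t _ Hn.
    rewrite Derive_iter_0. change (0 < (t - t0) * 1 * (t - t0)).
    assert (0 < (t - t0) ^ 2) by (apply pow2_gt_0; intros e; apply Hn; lra). lra.
  - apply (punctured_monotone_comp (reflection r) (iter_reflection r n)).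
    + intros x. apply ex_derive_reflection. lra.
    + intros x. apply ex_derive_iter_reflection. lra.
    + apply IH.
    + now apply punctured_monotone_reflection.
Qed.

Lemma tangent_iter_reflection (r : R) (n : nat) (phi : R) : 0 < r < 1 ->
  on_circle (iter_reflection r n phi) = on_circle phi ->
  caustic_defined (iter_reflection r n) phi ->
  tangent_to_circle_at (caustic (iter_reflection r n)) phi.
Proof.
  intros Hr H1 H2. apply tangent_at_fixed_point; try easy.
  - apply (ex_derive_continuous (iter_reflection r n)).
    apply ex_derive_iter_reflection. lra.
  - apply continuous_Derive_iter. lra.
  - now apply punctured_monotone_iter.
Qed.

(** * Points on the axis, vertical chords and orbits of period two *)

Lemma reflection_sin_zero (r x : R) : 0 <= r < 1 -> sin x = 0 ->
  reflection r x = x + PI.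
Proof.
  intros Hr H. unfold reflection. rewrite alpha_atan, H by easy.
  unfold Rdiv. rewrite Rmult_0_r, Rmult_0_l, atan_0. ring.
Qed.

Lemma iter_reflection_sin_zero (r : R) (n : nat) (x : R) : 0 <= r < 1 -> sin x = 0 ->
  iter_reflection r n x = x + INR n * PI /\ sin (iter_reflection r n x) = 0.
Proof.
  intros Hr H. induction n as [|n [IH1 IH2]].
  - simpl. split; [ring|easy].
  - change (iter_reflection r (S n) x) with (reflection r (iter_reflection r n x)).
    rewrite reflection_sin_zero by easy. split.
    + rewrite IH1, S_INR. ring.
    + now rewrite neg_sin, IH2, Ropp_0.
Qed.

(** The endpoints of the chord from [x] to [reflection r x] have half sum [x - alpha r x + PI / 2],
    so the chord has direction [x - alpha r x] up to sign; the hypothesis says that it is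
    vertical. *)
Lemma reflection_vertical (r x : R) : cos (x - alpha r x) = 0 ->
  cos (reflection r x) = cos x /\ sin (reflection r x) = - sin x.
Proof.
  intros H. set (b := x - alpha r x) in *.
  replace (reflection r x) with (- x + (2 * b + PI))
    by (unfold reflection, b; ring).
  assert (C : cos (2 * b + PI) = 1) by (rewrite neg_cos, cos_2a_cos, H; ring).
  assert (S : sin (2 * b + PI) = 0) by (rewrite neg_sin, sin_2a, H; ring).
  set (q := 2 * b + PI) in *.
  rewrite cos_plus, sin_plus, C, S, cos_neg, sin_neg. split; ring.
Qed.

(** Expanding [rho * cos (x - alpha r x)] with [alpha_polar] gives the quadratic with the opposite
    sign. *)
Lemma vertical_iff (r x : R) : 0 <= r < 1 ->
  cos (x - alpha r x) = 0 <-> 2 * r * cos x ^ 2 - cos x - r = 0.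
Proof.
  intros Hr. destruct (alpha_polar r x Hr) as [_ [rho [Hp [Hc Hs]]]].
  assert (S := sin_cos_sqr x).
  assert (E : rho * cos (x - alpha r x) = - (2 * r * cos x ^ 2 - cos x - r)).
  { rewrite cos_minus. transitivity
      (cos x * (rho * cos (alpha r x)) + sin x * (rho * sin (alpha r x))); [ring|].
    rewrite Hc, Hs. nra. }
  split; intros H.
  - rewrite H in E. lra.
  - rewrite H in E. apply Rmult_eq_reg_l with rho; lra.
Qed.

Lemma period_two_cases (r x : R) : 0 < r < 1 ->
  reflection r (reflection r x) = x + 2 * PI ->
  sin x = 0 \/ cos (x - alpha r x) = 0.
Proof.
  intros Hr H. set (y := reflection r x) in *.
  assert (Ey : y = x + PI - 2 * alpha r x) by reflexivity.
  assert (Ea : alpha r y = - alpha r x) by (unfold reflection in H; lra).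
  (* Sine rule in the triangle formed by the origin, the source and [z]. *)
  assert (G : forall z, sin (alpha r z) = r * sin (z + alpha r z)).
  { intros z. destruct (alpha_polar r z ltac:(lra)) as [_ [rho [Hp [Hc Hs]]]].
    apply Rmult_eq_reg_l with rho; [|lra]. rewrite sin_plus.
    transitivity (r * (sin z * (rho * cos (alpha r z)) + cos z * (rho * sin (alpha r z))));
      [|ring].
    rewrite Hc, Hs. ring. }
  destruct (alpha_polar r x ltac:(lra)) as [Hcp [rho [Hp [Hc Hs]]]].
  assert (G1 := G x). assert (G2 := G y). rewrite Ea, Ey, sin_neg in G2.
  set (a := alpha r x) in *.
  replace (x + PI - 2 * a + - a) with (x - 3 * a + PI) in G2 by ring.
  rewrite neg_sin in G2.
  assert (E : sin (x + a) - sin (x - 3 * a) = 0).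
  { apply Rmult_eq_reg_l with r; lra. }
  rewrite form4 in E.
  replace ((x + a - (x - 3 * a)) / 2) with (2 * a) in E by field.
  replace ((x + a + (x - 3 * a)) / 2) with (x - a) in E by field.
  rewrite sin_2a in E.
  (* The factor [cos (x - a)] gives the vertical chord. Otherwise [sin a * cos a = 0] with
     [cos a > 0], so [sin a = 0]. *)
  apply Rmult_integral in E. destruct E as [E|E]; [right; lra|left].
  assert (Sa : sin a = 0) by (apply Rmult_eq_reg_l with (2 * cos a); lra).
  rewrite Sa in Hs. apply Rmult_eq_reg_l with r; lra.
Qed.

(** * Monotonicity and rotation number for [r <= 1 / 3] *)

Lemma on_circle_eq_mod (x y : R) : on_circle x = on_circle y ->
  exists k : Z, x - y = IZR k * (2 * PI).
Proof.
  intros H. destruct (on_circle_inj _ _ H) as [Hc Hs].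
  destruct (sin_eq_0_0 ((x - y) / 2)) as [k Hk].
  - assert (A := cos_half (x - y)). rewrite cos_minus, Hc, Hs in A.
    assert (B := sin_cos_sqr y). nra.
  - exists k. lra.
Qed.

(** The numerator of the derivative is least where the cosine is 1, with value
    [(1 - 3 * r) * (1 - r)]. *)
Lemma reflection_le (r x y : R) : 0 <= r <= 1 / 3 -> x <= y ->
  reflection r x <= reflection r y.
Proof.
  intros Hr [L|E]; [|rewrite E; apply Rle_refl].
  destruct (MVT_open (reflection r) x y) as [z [E _]].
  - intros z. apply ex_derive_reflection. lra.
  - lra.
  - assert (0 <= reflection_deriv r z).
    { unfold reflection_deriv. apply Rmult_le_pos.
      - assert (C := COS_bound z). nra.
      - left. apply Rinv_0_lt_compat. apply reflection_deriv_den. lra. }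
    rewrite Derive_reflection in E by lra. nra.
Qed.

Lemma iter_reflection_le (r : R) (n : nat) (x y : R) : 0 <= r <= 1 / 3 -> x <= y ->
  iter_reflection r n x <= iter_reflection r n y.
Proof.
  intros Hr H. induction n as [|n IH]; [easy|].
  now apply reflection_le.
Qed.

(** Multiples of [PI] advance by exactly [INR n * PI], and by monotonicity [x] stays between the
    images of the two consecutive multiples that enclose it. *)
Lemma iter_reflection_confined (r : R) (n : nat) (x : R) : 0 <= r <= 1 / 3 ->
  Rabs (iter_reflection r n x - x - INR n * PI) <= PI.
Proof.
  intros Hr. assert (HP := PI_RGT_0).
  destruct (archimed (x / PI)) as [A1 A2]. set (k := up (x / PI)) in *.
  assert (X : x = x / PI * PI) by (field; lra).
  assert (B1 : IZR (k - 1) * PI <= x) by (rewrite minus_IZR; nra).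
  assert (B2 : x <= IZR k * PI) by nra.
  assert (S : forall j, sin (IZR j * PI) = 0) by (intros j; apply sin_eq_0_1; now exists j).
  assert (C1 := iter_reflection_le r n _ _ Hr B1).
  assert (C2 := iter_reflection_le r n _ _ Hr B2).
  rewrite (proj1 (iter_reflection_sin_zero r n _ ltac:(lra) (S _))) in C1.
  rewrite (proj1 (iter_reflection_sin_zero r n _ ltac:(lra) (S _))) in C2.
  rewrite minus_IZR in *. apply Rabs_le. lra.
Qed.

Lemma reflection_lift_nat (r x : R) (n : nat) :
  reflection r (x + INR n * (2 * PI)) = reflection r x + INR n * (2 * PI).
Proof.
  induction n as [|n IH].
  - simpl. now rewrite Rmult_0_l, !Rplus_0_r.
  - rewrite S_INR, !Rmult_plus_distr_r, !Rmult_1_l, <- !Rplus_assoc.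
    now rewrite reflection_lift, IH.
Qed.

Lemma iter_reflection_double_S (r : R) (n : nat) (x : R) :
  iter_reflection r (2 * S n) x = reflection r (reflection r (iter_reflection r (2 * n) x)).
Proof. now replace (2 * S n)%nat with (S (S (2 * n))) by lia. Qed.

Lemma period_reduces_to_two (r x : R) (m : nat) : 0 <= r <= 1 / 3 -> (1 <= m)%nat ->
  on_circle (iter_reflection r (2 * m) x) = on_circle x ->
  reflection r (reflection r x) = x + 2 * PI.
Proof.
  intros Hr Hm H. assert (HP := PI_RGT_0).
  destruct (on_circle_eq_mod _ _ H) as [k Hk].
  assert (B := iter_reflection_confined r (2 * m) x Hr).
  assert (Ex : iter_reflection r (2 * m) x = x + INR m * (2 * PI)).
  { rewrite Hk, mult_INR, (INR_IZR_INZ m) in B. simpl (INR 2) in B.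
    assert (K : (k = Z.of_nat m)%Z).
    { assert (Rabs (IZR (2 * (k - Z.of_nat m))) <= 1).
      { apply Rmult_le_reg_r with PI; [easy|].
        rewrite <- (Rabs_pos_eq PI) at 1 by lra. rewrite <- Rabs_mult.
        rewrite mult_IZR, minus_IZR. rewrite Rmult_1_l.
        eapply Rle_trans; [|apply B]. right. f_equal. simpl. ring. }
      rewrite Rabs_Zabs in H0. apply le_IZR in H0. lia. }
    rewrite K, <- INR_IZR_INZ in Hk. lra. }
  set (G := fun y => reflection r (reflection r y)).
  assert (Gm : forall y z, y <= z -> G y <= G z)
    by (intros y z L; now repeat apply reflection_le).
  assert (Gl : forall n y, G (y + INR n * (2 * PI)) = G y + INR n * (2 * PI))
    by (intros n y; unfold G; now rewrite !reflection_lift_nat).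
  destruct m as [|m]; [lia|].
  change (G x = x + 2 * PI).
  destruct (Rtotal_order (G x) (x + 2 * PI)) as [L|[E|L]]; [exfalso|easy|exfalso].
  (* [G] is monotone and commutes with translations by [2 * PI], so a strict deficit after one step
     of [G] persists and contradicts [Ex]; a surplus is treated symmetrically. *)
  - assert (I : forall n, iter_reflection r (2 * S n) x <= G x + INR n * (2 * PI)).
    { induction n as [|n IH]; [simpl; unfold G; lra|].
      rewrite iter_reflection_double_S. change (reflection r (reflection r ?y)) with (G y).
      apply Gm in IH. rewrite Gl in IH.
      assert (G (G x) <= G (x + INR 1 * (2 * PI))) by (apply Gm; simpl; lra).
      rewrite Gl in H0. rewrite S_INR. simpl in H0. unfold G in *. lra. }
    specialize (I m). rewrite Ex, S_INR in I. lra.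
  - assert (I : forall n, G x + INR n * (2 * PI) <= iter_reflection r (2 * S n) x).
    { induction n as [|n IH]; [simpl; unfold G; lra|].
      rewrite iter_reflection_double_S. change (reflection r (reflection r ?y)) with (G y).
      apply Gm in IH. rewrite Gl in IH.
      assert (G (x + INR 1 * (2 * PI)) <= G (G x)) by (apply Gm; simpl; lra).
      rewrite Gl in H0. rewrite S_INR. simpl in H0. unfold G in *. lra. }
    specialize (I m). rewrite Ex, S_INR in I. lra.
Qed.

(** * Derivatives of the iterates along special orbits *)

Lemma Derive_iter_nonneg (r : R) (n : nat) (x : R) : 0 < r <= 1 / 3 ->
  0 <= Derive (iter_reflection r n) x /\
  (Derive (iter_reflection r n) x = 0 -> sin (iter_reflection r n x) = 0).
Proof.
  intros Hr. induction n as [|n [IH1 IH2]].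
  - rewrite Derive_iter_0. lra.
  - rewrite Derive_iter_S by lra.
    change (iter_reflection r (S n) x) with (reflection r (iter_reflection r n x)).
    set (y := iter_reflection r n x) in *.
    assert (C := COS_bound y). assert (Hd := reflection_deriv_den r y ltac:(lra)).
    (* Both summands are nonnegative, so the numerator can vanish only where [cos y = 1]. *)
    assert (N : 1 + 3 * r ^ 2 - 4 * r * cos y = (1 - 3 * r) * (1 - r) + 4 * r * (1 - cos y))
      by ring.
    assert (N1 : 0 <= (1 - 3 * r) * (1 - r)) by nra.
    assert (N2 : 0 <= r * (1 - cos y)) by nra.
    split.
    + apply Rmult_le_pos; [|easy]. unfold reflection_deriv.
      apply Rmult_le_pos; [lra|]. left. now apply Rinv_0_lt_compat.
    + intros E. assert (Sy : sin y = 0).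
      { apply Rmult_integral in E. destruct E as [E|E]; [|now apply IH2].
        unfold reflection_deriv, Rdiv in E. apply Rmult_integral in E.
        destruct E as [E|E]; [|now apply Rinv_neq_0_compat in E; lra].
        assert (A := sin_cos_sqr y). assert (cos y = 1) by nra. nra. }
      rewrite reflection_sin_zero by (lra || easy). now rewrite neg_sin, Sy, Ropp_0.
Qed.

(** The orbit alternates between [x] and [- x] modulo [2 * PI], and [reflection_deriv] depends only
    on the cosine, so all chain rule factors agree. *)
Lemma iter_reflection_vertical (r x : R) (n : nat) : 0 < r < 1 ->
  2 * r * cos x ^ 2 - cos x - r = 0 ->
  cos (iter_reflection r n x) = cos x /\
  sin (iter_reflection r n x) = (-1) ^ n * sin x /\
  Derive (iter_reflection r n) x = reflection_deriv r x ^ n.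
Proof.
  intros Hr V. induction n as [|n [IH1 [IH2 IH3]]].
  - rewrite Derive_iter_0. simpl. lra.
  - rewrite Derive_iter_S by lra.
    change (iter_reflection r (S n) x) with (reflection r (iter_reflection r n x)).
    destruct (reflection_vertical r (iter_reflection r n x)) as [A B].
    { apply vertical_iff; [lra|]. now rewrite IH1. }
    rewrite A, B, IH1, IH2, IH3. repeat split; simpl; [ring|].
    unfold reflection_deriv at 1. now rewrite IH1.
Qed.

(** The orbit alternates between [0] and [PI] modulo [2 * PI], where the chain rule factors are
    [(1 - 3 * r) / (1 - r)] and [(1 + 3 * r) / (1 + r)]. *)
Lemma Derive_iter_sin_zero (r x : R) (m : nat) : 0 < r < 1 -> sin x = 0 ->
  Derive (iter_reflection r (2 * m)) x = ((1 - 9 * r ^ 2) / (1 - r ^ 2)) ^ m.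
Proof.
  intros Hr H. induction m as [|m IH].
  - apply Derive_iter_0.
  - replace (2 * S m)%nat with (S (S (2 * m))) by lia.
    rewrite !Derive_iter_S, IH by lra.
    change (iter_reflection r (S (2 * m)) x) with
      (reflection r (iter_reflection r (2 * m) x)).
    destruct (iter_reflection_sin_zero r (2 * m) x ltac:(lra) H) as [_ S].
    set (y := iter_reflection r (2 * m) x) in *.
    rewrite reflection_sin_zero by (lra || easy).
    rewrite <- (tech_pow_Rmult (_ / _) m), <- Rmult_assoc.
    apply (f_equal (fun z => z * _)). unfold reflection_deriv. rewrite neg_cos.
    assert (C : cos y = 1 \/ cos y = -1).
    { assert (A := sin_cos_sqr y). rewrite S in A.
      assert (E : (cos y - 1) * (cos y + 1) = 0) by lra.
      apply Rmult_integral in E. lra. }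
    assert (0 < (1 - r) ^ 2) by (apply pow2_gt_0; lra).
    assert (0 < (1 + r) ^ 2) by (apply pow2_gt_0; lra).
    destruct C as [-> | ->]; field; repeat split; nra.
Qed.

(** Tells when the denominator of the caustic can vanish at [0] and [PI]. *)
Lemma pow_eq_m1 (p : R) (m : nat) : (1 <= m)%nat -> 1 + p ^ m = 0 ->
  p = -1 /\ ~ Nat.Even m.
Proof.
  intros Hm H.
  assert (O : ~ Nat.Even m).
  { intros [k ->]. rewrite pow_mult in H.
    assert (0 <= (p ^ 2) ^ k) by (apply pow_le, pow2_ge_0). lra. }
  split; [|easy].
  assert (A : Rabs p = 1).
  { assert (Q : Rabs p ^ m = 1).
    { rewrite RPow_abs. replace (p ^ m) with (-1) by lra. rewrite Rabs_left; lra. }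
    destruct (Rtotal_order (Rabs p) 1) as [L|[E|L]]; [|easy|].
    - assert (Rabs p ^ m < 1); [|lra]. apply pow_lt_1_compat; [|lia].
      split; [apply Rabs_pos|easy].
    - assert (1 < Rabs p ^ m); [|lra]. apply Rlt_pow_R1; [easy|lia]. }
  unfold Rabs in A. destruct Rcase_abs; [lra|].
  rewrite A, pow1 in H. lra.
Qed.

(** * Points of the caustic on the circle *)

(** The caustic point divides the chord with weights [D] and 1, so [(1 + D) ^ 2] times one minus its
    squared modulus equals [D] times the squared chord length. *)
Lemma caustic_unit (f : R -> R) (x : R) : 0 <= Derive f x ->
  Cmod (caustic f x) = 1 -> Derive f x = 0 \/ on_circle (f x) = on_circle x.
Proof.
  intros HD H.
  assert (Q : Cmod (caustic f x) ^ 2 = 1) by (rewrite H; ring).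
  rewrite Cmod2_alt in Q. unfold caustic, Re, Im in Q. simpl fst in Q. simpl snd in Q.
  set (D := Derive f x) in *.
  destruct (Req_dec D 0) as [E|E]; [now left|right].
  assert (A := sin_cos_sqr x). assert (B := sin_cos_sqr (f x)).
  assert (G : D * ((cos (f x) - cos x) ^ 2 + (sin (f x) - sin x) ^ 2) = 0).
  { transitivity ((1 + D) ^ 2 * (1 - (((D * cos x + cos (f x)) / (1 + D)) ^ 2 +
       ((D * sin x + sin (f x)) / (1 + D)) ^ 2))); [|rewrite Q; ring].
    replace ((1 + D) ^ 2 * (1 - (((D * cos x + cos (f x)) / (1 + D)) ^ 2 +
       ((D * sin x + sin (f x)) / (1 + D)) ^ 2))) with
      ((1 + D) ^ 2 - (D * cos x + cos (f x)) ^ 2 - (D * sin x + sin (f x)) ^ 2)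
      by (field; lra).
    assert (As : sin x ^ 2 = 1 - cos x ^ 2) by lra.
    assert (Bs : sin (f x) ^ 2 = 1 - cos (f x) ^ 2) by lra.
    ring_simplify. rewrite As, Bs. ring. }
  apply Rmult_integral in G. destruct G as [G|G]; [easy|].
  assert (P1 := pow2_ge_0 (cos (f x) - cos x)). assert (P2 := pow2_ge_0 (sin (f x) - sin x)).
  apply on_circle_eq; apply Rminus_diag_uniq, Rsqr_0_uniq; unfold Rsqr; lra.
Qed.

Lemma sin_zero_on_circle (x : R) : sin x = 0 ->
  on_circle x = on_circle 0 \/ on_circle x = on_circle PI.
Proof.
  intros S. assert (A := sin_cos_sqr x). rewrite S in A.
  assert (E : (cos x - 1) * (cos x + 1) = 0) by lra.
  apply Rmult_integral in E. destruct E; [left|right]; apply on_circle_eq;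
    rewrite ?cos_0, ?sin_0, ?cos_PI, ?sin_PI; lra.
Qed.

Lemma cos_eq_on_circle (x y : R) : cos x = cos y ->
  on_circle x = on_circle y \/ on_circle x = on_circle (- y).
Proof.
  intros C. assert (A := sin_cos_sqr x). assert (B := sin_cos_sqr y). rewrite C in A.
  assert (E : (sin x - sin y) * (sin x + sin y) = 0) by lra.
  apply Rmult_integral in E. destruct E; [left|right]; apply on_circle_eq;
    rewrite ?cos_neg, ?sin_neg; lra.
Qed.

(** The other root, [(1 + sqrt (1 + 8 * r ^ 2)) / (4 * r)], exceeds 1 and is not a cosine; [s3]
    expresses this. *)
Lemma vertical_root (r : R) : 0 < r < 1 ->
  let c0 := (1 - sqrt (1 + 8 * r ^ 2)) / (4 * r) in
  -1 < c0 < 1 /\ 2 * r * c0 ^ 2 - c0 - r = 0 /\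
  forall c, c <= 1 -> 2 * r * c ^ 2 - c - r = 0 -> c = c0.
Proof.
  intros Hr c0. set (s := sqrt (1 + 8 * r ^ 2)) in c0.
  assert (Hs : s * s = 1 + 8 * r ^ 2) by (apply sqrt_sqrt; nra).
  assert (Hs0 : 0 <= s) by apply sqrt_pos.
  assert (Ec : 4 * r * c0 = 1 - s) by (unfold c0; field; lra).
  assert (s1 : 1 < s) by nra.
  assert (s2 : s < 1 + 4 * r) by nra.
  assert (s3 : 4 * r - 1 < s) by nra.
  split; [split; nra|]. split.
  - apply Rmult_eq_reg_l with (8 * r); [|lra].
    replace (8 * r * (2 * r * c0 ^ 2 - c0 - r)) with
      ((4 * r * c0) ^ 2 - 2 * (4 * r * c0) - 8 * r ^ 2) by ring.
    rewrite Ec. nra.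
  - intros c Hc E.
    assert (F : (4 * r * c - 1 - s) * (4 * r * c - 1 + s) = 0) by nra.
    apply Rmult_integral in F. destruct F as [F|F]; [nra|].
    apply Rmult_eq_reg_l with (4 * r); lra.
Qed.

(** At [0] and [PI] the derivative of [f] is [((1 - 9 * r ^ 2) / (1 - r ^ 2)) ^ m], which equals -1
    exactly when [5 * r ^ 2 = 1] and [m] is odd; the caustic then has no point at these parameters,
    hence the side condition. At [phic] and [- phic] the derivative is an even power. *)
Theorem proposition4p2 (r : R) (m : nat) (hr : 0 < r < 1) (hm : (1 <= m)%nat) :
  let f := iter_reflection r (2 * m) in
  (forall phi : R,
     on_circle (f phi) = on_circle phi ->
     caustic_defined f phi ->
     tangent_to_circle_at (caustic f) phi) /\
  exists phic : R,
    (0 < phic < PI /\ cos phic = (1 - sqrt (1 + 8 * r ^ 2)) / (4 * r)) /\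
    (forall phi : R, In phi (0 :: PI :: phic :: - phic :: nil) ->
       on_circle (f phi) = on_circle phi) /\
    (forall phi : R, In phi (phic :: - phic :: nil) ->
       caustic_defined f phi /\ tangent_to_circle_at (caustic f) phi) /\
    (forall phi : R, In phi (0 :: PI :: nil) ->
       5 * r ^ 2 <> 1 \/ Nat.Even m ->
       caustic_defined f phi /\ tangent_to_circle_at (caustic f) phi) /\
    (r <= 1 / 3 ->
       NoDup (map on_circle (0 :: PI :: phic :: - phic :: nil)) /\
       forall P : C,
         caustic_meets_circle f P <->
         In P (map on_circle (0 :: PI :: phic :: - phic :: nil))).
Proof.
  intros f.
  assert (T : forall phi, on_circle (f phi) = on_circle phi -> caustic_defined f phi ->
     tangent_to_circle_at (caustic f) phi)
    by (intros phi; now apply tangent_iter_reflection).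
  split; [exact T|].
  destruct (vertical_root r hr) as [B [Q U]].
  set (c0 := (1 - sqrt (1 + 8 * r ^ 2)) / (4 * r)) in *.
  set (phic := acos c0). exists phic.
  assert (Cp : cos phic = c0) by (apply cos_acos; lra).
  assert (Bp : 0 < phic < PI) by now apply acos_bound_lt.
  assert (Vfix : forall phi, In phi (phic :: - phic :: nil) ->
     on_circle (f phi) = on_circle phi /\ caustic_defined f phi).
  { intros phi Hphi.
    assert (Cphi : cos phi = c0)
      by (destruct Hphi as [<-|[<-|[]]]; rewrite ?cos_neg; easy).
    destruct (iter_reflection_vertical r phi (2 * m) hr) as [V1 [V2 V3]];
      [now rewrite Cphi|].
    split.
    - apply on_circle_eq; [easy|]. unfold f. rewrite V2, pow_1_even. ring.
    - unfold caustic_defined, f. rewrite V3, pow_mult.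
      assert (0 <= (reflection_deriv r phi ^ 2) ^ m) by apply pow_le, pow2_ge_0. lra. }
  assert (Hfix : forall phi, In phi (0 :: PI :: nil) -> on_circle (f phi) = on_circle phi).
  { intros phi Hphi.
    assert (S : sin phi = 0) by (destruct Hphi as [<-|[<-|[]]]; auto using sin_0, sin_PI).
    unfold f. rewrite (proj1 (iter_reflection_sin_zero r (2 * m) phi ltac:(lra) S)).
    rewrite mult_INR. replace (phi + INR 2 * INR m * PI) with (phi + 2 * INR m * PI)
      by (simpl; ring).
    apply on_circle_eq; [apply cos_period|apply sin_period]. }
  assert (Hdef : forall phi, In phi (0 :: PI :: nil) -> 5 * r ^ 2 <> 1 \/ Nat.Even m ->
     caustic_defined f phi).
  { intros phi Hphi Hc E.
    assert (S : sin phi = 0) by (destruct Hphi as [<-|[<-|[]]]; auto using sin_0, sin_PI).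
    unfold f in E. rewrite Derive_iter_sin_zero in E by easy.
    destruct (pow_eq_m1 _ _ hm E) as [P O]. destruct Hc as [Hc|Hc]; [|easy].
    apply Hc. assert (1 - r ^ 2 <> 0) by nra.
    assert (1 - 9 * r ^ 2 = -1 * (1 - r ^ 2)) by (rewrite <- P; now field). lra. }
  assert (Hall : forall phi, In phi (0 :: PI :: phic :: - phic :: nil) ->
     on_circle (f phi) = on_circle phi).
  { intros phi [H|[H|H]]; [apply Hfix; simpl; tauto|apply Hfix; simpl; tauto|].
    now apply Vfix. }
  split; [easy|]. split; [exact Hall|]. split.
  { intros phi H. destruct (Vfix phi H). split; [easy|]. now apply T. }
  split.
  { intros phi H Hc. split; [now apply Hdef|]. apply T; [now apply Hfix|now apply Hdef]. }
  intros Hr3.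
  assert (Sp : 0 < sin phic) by (apply sin_gt_0; lra).
  split.
  - simpl map. unfold on_circle.
    rewrite cos_0, sin_0, cos_PI, sin_PI, cos_neg, sin_neg.
    repeat (apply NoDup_cons;
      [simpl; intros X; repeat destruct X as [X|X]; try easy; injection X; intros; lra|]).
    apply NoDup_nil.
  - intros P. split.
    + intros [[phi [Hd <-]] Hm].
      destruct (Derive_iter_nonneg r (2 * m) phi ltac:(lra)) as [D1 D2]. fold f in D1, D2.
      destruct (caustic_unit f phi D1 Hm) as [E|E].
      (* Where the derivative vanishes, the caustic point is the far endpoint [f phi], which [D2]
         puts on the axis. *)
      * assert (G : caustic f phi = on_circle (f phi)).
        { unfold caustic, on_circle. rewrite E. f_equal; field. }
        rewrite G. simpl.
        destruct (sin_zero_on_circle _ (D2 E)) as [F|F]; rewrite F; tauto.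
      * rewrite (proj1 (T phi E Hd)). simpl.
        assert (R2 := period_reduces_to_two r phi m ltac:(lra) hm E).
        destruct (period_two_cases r phi hr R2) as [S|V].
        -- destruct (sin_zero_on_circle _ S) as [F|F]; rewrite F; tauto.
        -- apply vertical_iff in V; [|lra].
           assert (Cphi : cos phi = cos phic)
             by (rewrite Cp; apply U; [apply COS_bound|easy]).
           destruct (cos_eq_on_circle _ _ Cphi) as [F|F]; rewrite F; tauto.
    + intros H. apply in_map_iff in H. destruct H as [phi [<- H]].
      assert (Hd : caustic_defined f phi).
      (* For [r <= 1 / 3] the exceptional value is out of reach: [5 * r ^ 2] is at most 5/9. *)
      { destruct H as [H|[H|H]]; [| |now apply Vfix];
          (apply Hdef; [simpl; tauto|left; nra]). }
      split; [|apply Cmod_on_circle].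
      exists phi. split; [easy|]. apply (proj1 (T phi (Hall phi H) Hd)).
Qed.
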